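(* Let $D$ be a discrete derivative operator of order $p>2$, and let $m\ge1$ (the scalar-valued case $m=1$ being included). Then there is no general averaging operator $A_{f'}$ of any order $q\in\mathbb{N}$ such that the chain rule $$D\bigl(f(\mathbf{u})\bigr)=(A_{f'}\mathbf{u})\cdot(D\mathbf{u})$$ holds for all smooth functions $f\colon\mathbb{R}^m\to\mathbb{R}$ and all grid functions $\mathbf{u}$ with values in $\mathbb{R}^m$.
   Context: Consider (possibly non-uniform) grids with distinct ordered nodes $x_i\in\mathbb{R}$ and $h:=\min_i(x_{i+1}-x_i)>0$; asymptotic statements $\mathcal{O}(h^r)$ refer to a family of such grids with $h\to0$. A grid function is a family $\mathbf{u}=(\mathbf{u}_i)_i$ of values (in $\mathbb{R}^m$) at the nodes; a function $u$ gives the grid function $\mathbf{u}_i=u(x_i)$. Compositions are pointwise: $f(\mathbf{u})_i=f(\mathbf{u}_i)$. $f'$ is the gradient of $f$ and $\cdot$ is the Euclidean inner product, taken node by node. A discrete derivative operator $D$ is a linear operator on grid functions on each grid of the family, given by a matrix: $(D\mathbf{u})_i=\sum_j D_{ij}\mathbf{u}_j$ (finite sums, acting componentwise on vector-valued grid functions). It is of order $p$ if $(D\mathbf{u})_i=u'(x_i)+\mathcal{O}(h^p)$ for smooth $u$, or, equivalently (this is the form to be used), if at every node it is exact for all polynomials of degree $\le p$, i.e. $\sum_j D_{ij}\,u(x_j)=u'(x_i)$ for every real polynomial $u$ of degree $\le p$, with $p$ maximal. A general averaging operator of order $q$ is an assignment to each smooth $f\colon\mathbb{R}^m\to\mathbb{R}$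 of a (not necessarily linear) map $A_{f'}$ sending $\mathbb{R}^m$-valued grid functions to $\mathbb{R}^m$-valued grid functions on each grid of the family, such that $(A_{f'}\mathbf{u})_i=f'(u(x_i))+\mathcal{O}(h^q)$ for every smooth function $u$ with $\mathbf{u}_i=u(x_i)$. The chain rule is meant to hold at every node on every grid of the family. *)

(* Defs.v *)
From HB Require Import structures.
From mathcomp Require Import all_boot all_order all_algebra.
From mathcomp Require Import all_classical all_reals all_analysis.

Set Implicit Arguments.
Unset Strict Implicit.
Unset Printing Implicit Defensive.
Import Order.TTheory GRing.Theory Num.Theory.
Import numFieldNormedType.Exports.
Local Open Scope classical_set_scope.
Local Open Scope ring_scope.

Definition gaps (R : realType) (I : interval int)
    (x : {i : int | i \in I} -> R) : set R :=
  [set d | exists i j, val j = val i + 1 /\ d = x j - x i].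

(* The indices are consecutive integers; the index range may be finite,
   half-infinite or all of int.  The constraint [mesh_min] determines [mesh]:
   it is h = min_i (x_(i+1) - x_i), which is positive by [mesh_gt0] below. *)
Record grid (R : realType) := Grid {
  index_range : interval int ;
  node : {i : int | i \in index_range} -> R ;
  node_lt : forall i j, val i < val j -> node i < node j ;
  mesh : R ;
  mesh_min : gaps node mesh /\ lbound (gaps node) mesh }.

Definition gindex (R : realType) (g : grid R) := {i : int | i \in index_range g}.

Lemma mesh_gt0 (R : realType) (g : grid R) : 0 < mesh g.
Proof.
have [[i [j [ij ->]]] _] := mesh_min g.
by rewrite subr_gt0; apply: node_lt; rewrite ij ltrDl.
Qed.

Definition gridfun (R : realType) (g : grid R) (V : Type) := gindex g -> V.

Definition restrict_to_grid (R : realType) (g : grid R) (V : Type) (u : R -> V) :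
  gridfun g V := fun i => u (node i).
Arguments restrict_to_grid {R} g {V} u.

(* Rows are finitely supported: [\sum_(j \in A) _] is the junk value 0 on
   infinitely supported families. *)
Record grid_op (R : realType) (g : grid R) := GridOp {
  coeff : gindex g -> gindex g -> R ;
  coeff_finite : forall i, finite_set [set j | coeff i j != 0] }.

(* [V] is R itself for scalar-valued grid functions. *)
Definition apply_op (R : realType) (g : grid R) (D : grid_op g)
    (V : normedModType R) (u : gridfun g V) : gridfun g V :=
  fun i => \sum_(j \in [set: gindex g]) coeff D i j *: u j.

Section Families.
Variables (R : realType) (K : Type) (G : K -> grid R).
Variable D : forall k, grid_op (G k).

Definition exact_upto (p : nat) :=
  forall (P : {poly R}), (size P <= p.+1)%N ->
  forall k (i : gindex (G k)),
    apply_op (D k) (restrict_to_grid (G k) (horner P)) i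
    = (deriv P).[node i].

Definition derivative_order (p : nat) :=
  exact_upto p /\ forall r, exact_upto r -> (r <= p)%N.

End Families.

Definition iter_derive (R : realType) (V W : normedModType R)
    (s : seq V) (f : V -> W) : V -> W :=
  foldr (fun v g => 'D_v g) f s.

(* C^oo on a finite-dimensional V: directional derivatives of all orders exist
   and are continuous. *)
Definition smooth (R : realType) (V W : normedModType R) (f : V -> W) :=
  forall s : seq V, continuous (iter_derive s f) /\
    forall v x, derivable (iter_derive s f) x v.

Definition gradient (R : realType) (m : nat) (f : 'rV[R]_m -> R)
    (x : 'rV[R]_m) : 'rV[R]_m :=
  \row_j 'D_(delta_mx 0 j) f x.

Definition dotv (R : realType) (m : nat) (u v : 'rV[R]_m) : R :=
  \sum_(j < m) u 0 j * v 0 j.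

(* [A f k] is the map A_{f'} on the grid [G k]; only its values at smooth [f]
   are ever constrained or used. *)
Definition averaging (R : realType) (K : Type) (G : K -> grid R) (m : nat) :=
  forall (f : 'rV[R]_m -> R) (k : K),
    gridfun (G k) 'rV[R]_m -> gridfun (G k) 'rV[R]_m.

(* The limit h -> 0 is taken along the filter [F].  The constant in O(h^q) is
   uniform over the nodes in a bounded interval: on grids that extend over the
   whole line, no uniformity at infinity is asked for. *)
Definition averaging_order (R : realType) (K : Type) (F : set_system K)
    (G : K -> grid R) (m : nat) (A : averaging G m) (q : nat) :=
  forall (f : 'rV[R]_m -> R) (u : R -> 'rV[R]_m), smooth f -> smooth u ->
  forall a b : R, exists C : R, \forall k \near F,
    forall i : gindex (G k), a <= node i <= b ->
      `|A f k (restrict_to_grid (G k) u) i - gradient f (u (node i))|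
      <= C * mesh (G k) ^+ q.

Definition chain_rule (R : realType) (K : Type) (G : K -> grid R)
    (D : forall k, grid_op (G k)) (m : nat) (A : averaging G m) :=
  forall f : 'rV[R]_m -> R, smooth f ->
  forall (k : K) (u : gridfun (G k) 'rV[R]_m) (i : gindex (G k)),
    apply_op (D k) (f \o u) i = dotv (A f k u i) (apply_op (D k) u i).

(* Main.v *)
Require Import Defs.
From mathcomp Require Import all_boot all_order all_algebra finmap.
From mathcomp Require Import all_classical all_reals all_analysis.
From mathcomp Require Import ring lra.

Set Implicit Arguments.
Unset Strict Implicit.
Unset Printing Implicit Defensive.
Import Order.TTheory GRing.Theory Num.Theory.
Import numFieldNormedType.Exports.
Local Open Scope classical_set_scope.
Local Open Scope ring_scope.

(** The chain rule forces [D (f u) = 0] at every node where [D u = 0],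
    whatever the averaging operator is, so consistency of the averages plays
    no role: a contradiction already arises at a single node [x_i] of a single
    grid.  Write [t = x - x_i].  Exactness up to degree 3 gives [D u = 0] at
    [x_i] for every scalar [u = t^2 + e t^3], and [D t = 1] there.  Call
    stencil the set of nodes with a nonzero coefficient in row [i], let [x_a]
    be a stencil node with [|t_a|] largest, and take for [e] the sign of
    [t_a].  Then [t_a^2 + e t_a^3] is strictly larger than the other values of
    [u] on the stencil, hence a polynomial [f] vanishes at all of these but
    not at [u_a] ([separating_polynomial]).  So [D (f u)] at [x_i] is a nonzero
    multiple of the coefficient of [x_a]: it is not 0.  Vector values are
    covered by letting [u] run along the first coordinate axis and [f] depend
    on the first coordinate only; such an [f] is smooth
    ([smooth_horner_coord]). *)

Section HornerCoord.
Variables (R : realType) (m : nat) (j : 'I_m).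
Implicit Types (P : {poly R}) (x v : 'rV[R]_m).

Lemma is_derive_coord x v : is_derive x v (fun y : 'rV[R]_m => y 0 j) (v 0 j).
Proof.
have /derivable_mxP dx := @derivable_id R 'rV[R]_m x v.
apply: DeriveDef; first exact: dx.
by rewrite -[in RHS](derive_id x v) derive_mx ?mxE.
Qed.

Lemma is_derive_horner_coord P x v :
  is_derive x v (fun y : 'rV[R]_m => P.[y 0 j]) ((v 0 j *: P^`()).[x 0 j]).
Proof.
elim/poly_ind: P => [|P c IH].
  rewrite (_ : (fun _ => _) = cst 0); last by apply/funext => y; rewrite horner0.
  by rewrite deriv0 scaler0 horner0; exact: is_derive_cst.
rewrite (_ : (fun _ => _) =
    (fun y : 'rV[R]_m => P.[y 0 j]) * (fun y : 'rV[R]_m => y 0 j) + cst c).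
  apply: is_derive_eq.
    by apply: is_deriveD; apply: is_deriveM; exact: is_derive_coord.
  by rewrite derivMXaddC addr0 !hornerE /= /GRing.scale /=; ring.
by apply/funext => y; rewrite hornerMXaddC.
Qed.

Lemma iter_derive_horner_coord P (s : seq 'rV[R]_m) :
  exists Q : {poly R},
    iter_derive s (fun y : 'rV[R]_m => P.[y 0 j]) = (fun y => Q.[y 0 j]).
Proof.
elim: s => [|v s [Q IH]]; first by exists P.
exists (v 0 j *: Q^`()); rewrite /iter_derive /= -/(iter_derive _ _) IH.
by apply/funext => x; have d := is_derive_horner_coord Q x v; rewrite derive_val.
Qed.

Lemma smooth_horner_coord P : smooth (fun y : 'rV[R]_m => P.[y 0 j]).
Proof.
move=> s; have [Q ->] := iter_derive_horner_coord P s; split => [y|v x].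
  apply: (@continuous_comp _ _ _ (fun y : 'rV[R]_m => y 0 j) (horner Q)).
    exact: coord_continuous.
  exact: continuous_horner.
by have [] := is_derive_horner_coord Q x v.
Qed.

End HornerCoord.

(** Two points of equal modulus are opposite, so the sign [e] of [t a] makes
    the cubic term break the tie in favour of [a]. *)
Lemma cubic_lt_max_norm (R : realFieldType) (a b : R) :
  `|b| <= `|a| -> b != a ->
  b ^+ 2 + Num.sg a * b ^+ 3 < a ^+ 2 + Num.sg a * a ^+ 3.
Proof.
have sq (x y : R) : `|x| <= y -> x != y -> x ^+ 2 + x ^+ 3 < y ^+ 2 + y ^+ 3.
  rewrite ler_norml => /andP[yx xy] nxy.
  have {}xy : x < y by rewrite lt_neqAle nxy.
  have y0 : 0 < y by lra.
  rewrite -subr_gt0 (_ : _ - _ =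
    (y - x) * ((y + x) + ((x + y / 2) ^+ 2 + 3 / 4 * y ^+ 2))); last by field.
  rewrite mulr_gt0 ?subr_gt0 // ltr_wpDl ?ltr_wpDl ?sqr_ge0 //; first by lra.
  by rewrite mulr_gt0 ?exprn_gt0 //; lra.
move=> ba nba; case: (ltgtP a 0) => a0.
- rewrite ltr0_sg //; have := sq (- b) (- a).
  rewrite normrN eqr_opp -{1}(ltr0_norm a0) => /(_ ba nba).
  by congr (_ < _); ring.
- by rewrite gtr0_sg // !mul1r; apply: sq => //; rewrite -(gtr0_norm a0).
- by move: ba nba; rewrite a0 normr0 normr_le0 => ->.
Qed.

(** Nonzero coefficients on distinct points are told apart by the single curve
    [t^2 + e t^3]: composing it with a suitable polynomial gives a nonzero
    sum. *)
Lemma separating_polynomial (R : realFieldType) (I : finType) (c t : I -> R) :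
  (forall i, c i != 0) -> injective t -> \sum_i c i * t i != 0 ->
  exists (e : R) (P : {poly R}),
    \sum_i c i * P.[t i ^+ 2 + e * t i ^+ 3] != 0.
Proof.
move=> c0 tinj sum0.
(* a nonzero sum has an index set on which the maximum can be taken *)
have [i0 _] : exists i : I, true.
  case: (pickP I) => [i|noI]; first by exists i.
  by move: sum0; rewrite big_pred0 ?eqxx.
pose a := [arg max_(i > i0) `|t i|]%O.
have amax i : `|t i| <= `|t a|.
  by rewrite /a; case: arg_maxP => //= b _; apply.
pose u i := t i ^+ 2 + Num.sg (t a) * t i ^+ 3.
pose P : {poly R} := \prod_(i | i != a) ('X - (u i)%:P).
have P0 i : i != a -> P.[u i] = 0.
  by move=> ia; rewrite /P (bigD1 i) //= hornerM hornerXsubC subrr mul0r.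
exists (Num.sg (t a)), P; rewrite (bigD1 a) //=.
rewrite big1 ?addr0 => [|i ia]; last by rewrite P0 ?mulr0.
rewrite mulf_neq0 // horner_prod prodf_seq_neq0.
apply/allP => i _; apply/implyP => ia; rewrite hornerXsubC subr_eq0 gt_eqF //.
by apply: cubic_lt_max_norm; rewrite // (inj_eq tinj).
Qed.

(** The indices of the nodes with a nonzero coefficient in row [i]; sums over
    it are sums over a finite type. *)
Definition stencil (R : realType) (g : grid R) (D : grid_op g) (i : gindex g) :
  {fset gindex g} := fset_set [set j | coeff D i j != 0].

Section Stencil.
Variables (R : realType) (g : grid R) (D : grid_op g) (i : gindex g).

Lemma mem_stencil j : (j \in stencil D i) = (coeff D i j != 0).
Proof.
rewrite in_fset_set; last exact: coeff_finite.
by apply/idP/idP; rewrite inE.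
Qed.

Lemma coeff_stencil_neq0 (j : stencil D i) : coeff D i (val j) != 0.
Proof. by rewrite -mem_stencil; exact: fsvalP. Qed.

Lemma apply_opE (V : normedModType R) (u : gridfun g V) :
  apply_op D u i = \sum_(j : stencil D i) coeff D i (val j) *: u (val j).
Proof.
rewrite /apply_op (fsbigTE (stencil D i)) ?big_seq_fsetE // => j.
by rewrite mem_stencil negbK => /eqP ->; rewrite scale0r.
Qed.

End Stencil.

Lemma node_inj (R : realType) (g : grid R) : injective (@node R g).
Proof.
move=> i j ij; apply: val_inj; case: (ltgtP (val i) (val j)) => // /node_lt;
  by rewrite ij ltxx.
Qed.

Theorem theorem3p8 (R : realType) (K : Type) (F : set_system K)
    (FF : ProperFilter F) (G : K -> grid R)
    (mesh_to0 : mesh (G k) @[k --> F] --> (0 : R))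
    (D : forall k : K, grid_op (G k)) (p : nat)
    (Dp : derivative_order D p) (p_gt2 : (2 < p)%N)
    (m : nat) (m_gt0 : (0 < m)%N) :
  ~ exists (q : nat) (A : averaging G m),
      averaging_order F A q /\ chain_rule D A.
Proof.
case=> q [A [_ chain]].
have [k _] := @filter_ex _ F FF setT filterT.
have [[i _] _] := mesh_min (G k).
pose t (j : stencil (D k) i) := node (val j) - node i.
pose c (j : stencil (D k) i) := coeff (D k) i (val j).
pose tX : {poly R} := 'X - (node i)%:P.
have exact3 (P : {poly R}) : (size P <= 4)%N ->
    \sum_j c j * P.[node (val j)] = P^`().[node i].
  move=> sP; rewrite -(Dp.1 P) ?apply_opE //.
  exact: leq_trans sP _.
have tinj : injective t by move=> x y /addIr /node_inj /val_inj.
have [e [P]] : exists (e : R) (P : {poly R}),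
    \sum_j c j * P.[t j ^+ 2 + e * t j ^+ 3] != 0.
  apply: separating_polynomial => //; first exact: coeff_stencil_neq0.
  have := exact3 tX; rewrite size_XsubC derivXsubC hornerC => /(_ isT) D1.
  rewrite (eq_bigr (fun j => c j * tX.[node (val j)])) ?D1 ?oner_neq0 // => j _.
  by rewrite hornerXsubC.
apply/negP; rewrite negbK.
pose U : {poly R} := tX ^+ 2 + e *: tX ^+ 3.
have UE j : U.[node (val j)] = t j ^+ 2 + e * t j ^+ 3.
  by rewrite /U hornerD hornerZ !horner_exp !hornerXsubC.
have DU : \sum_j c j * U.[node (val j)] = 0.
  rewrite exact3.
    (* the node of row [i] is at least a double root of [U] *)
    rewrite /U derivD derivZ !deriv_exp derivXsubC !hornerE /= subrr; ring.
  rewrite (leq_trans (size_polyD _ _)) // geq_max size_exp_XsubC /=.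
  by rewrite (leq_trans (size_scale_leq _ _)) // size_exp_XsubC.
pose j0 := Ordinal m_gt0.
pose u : gridfun (G k) 'rV[R]_m := fun j => U.[node j] *: delta_mx 0 j0.
have Du : apply_op (D k) u i = 0.
  rewrite apply_opE (eq_bigr (fun j => (c j * U.[node (val j)]) *: delta_mx 0 j0)).
    by rewrite -scaler_suml DU scale0r.
  by move=> j _; rewrite scalerA.
have := chain _ (smooth_horner_coord j0 P) k u i.
rewrite Du /dotv big1 ?apply_opE => [|j _]; last by rewrite mxE mulr0.
move=> Df; apply/eqP; rewrite -[RHS]Df; apply: eq_bigr => j _.
by rewrite /= !mxE !eqxx mulr1 UE.
Qed.
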